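(* Let $n\in\mathbb{N}$ with $\gcd(n,6)=1$, and let $$C[n]=\langle x,y \mid x^n=y^n=(xy)^n=(xy^{-1})^n=(xy^{-2})^n=(xy^{-1}xy^{-2})^n=1\rangle.$$ Let $C[n]'$ be the commutator subgroup of $C[n]$, and let $N\le C[n]'$ be a normal subgroup of $C[n]$ of finite index. Then $C[n]/N$ admits an unmixed Beauville structure.
   Context: For a finite group $G$ and $a,c\in G$ put $\Sigma(a,c)=\bigcup_{g\in G}\bigcup_{i\ge 0}\{ga^ig^{-1},\,gc^ig^{-1},\,g(ac)^ig^{-1}\}$. An unmixed Beauville structure on $G$ is a quadruple $(a_1,c_1;a_2,c_2)$ of elements of $G$ such that $\langle a_1,c_1\rangle=G$, $\langle a_2,c_2\rangle=G$ and $\Sigma(a_1,c_1)\cap\Sigma(a_2,c_2)=\{1_G\}$. *)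

(* Defs.v *)
From HB Require Import structures.
From mathcomp Require Import all_boot.
From mathcomp Require Import boolp classical_sets functions cardinality.

Set Implicit Arguments.
Unset Strict Implicit.
Unset Printing Implicit Defensive.

Local Open Scope classical_set_scope.
Local Open Scope quotient_scope.
Local Open Scope group_scope.

(* Groups are arbitrary, possibly infinite, [groupType]s; subgroups are       *)
(* classical sets, since membership in them need not be decidable.            *)

Definition is_subgroup (G : groupType) (H : set G) : Prop :=
  [/\ H 1, forall x y, H x -> H y -> H (x * y) & forall x, H x -> H x^-1].

Definition is_normal (G : groupType) (H : set G) : Prop :=
  is_subgroup H /\ forall x g, H x -> H (x ^ g).

Definition gen (G : groupType) (A : set G) : set G :=
  smallest (@is_subgroup G) A.

Definition normal_closure (G : groupType) (A : set G) : set G :=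
  smallest (@is_normal G) A.

Definition derived_subgroup (G : groupType) : set G :=
  gen [set z | exists x y : G, z = [~ x, y]].
Arguments derived_subgroup : clear implicits.

Definition lcoset_of (G : groupType) (H : set G) (g : G) : set G :=
  [set g * h | h in H].

Definition finite_index (G : groupType) (H : set G) : Prop :=
  finite_set (range (lcoset_of H)).

Record normal_subgroup (G : groupType) := NormalSubgroup {
  normal_set :> set G;
  normal_setP : is_normal normal_set
}.

Lemma normal_closure_normal (G : groupType) (A : set G) :
  is_normal (normal_closure A).
Proof.
split=> [|x g Ax K [nK AK]]; last by apply: nK.2; apply: Ax.
split=> [K [[[]]] //|x y Ax Ay K KP|x Ax K KP].
- by case: (KP) => -[[_ mK _] _] _; apply: mK; [apply: Ax | apply: Ay].
- by case: (KP) => -[[_ _ iK] _] _; apply: iK; apply: Ax.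
Qed.

Definition normal_closure_group (G : groupType) (A : set G) :
    normal_subgroup G :=
  NormalSubgroup (normal_closure_normal A).

Section QuotientGroup.
Variables (G : groupType) (N : normal_subgroup G).

Let N1 : normal_set N 1. Proof. by case: (normal_setP N) => -[]. Qed.
Let NM x y : normal_set N x -> normal_set N y -> normal_set N (x * y).
Proof. by case: (normal_setP N) => -[_ + _ _]; apply. Qed.
Let NV x : normal_set N x -> normal_set N x^-1.
Proof. by case: (normal_setP N) => -[_ _ + _]; apply. Qed.
Let NJ x g : normal_set N x -> normal_set N (x ^ g).
Proof. by case: (normal_setP N) => _; apply. Qed.

Definition quot_rel : rel G := fun x y => `[< normal_set N (x^-1 * y) >].

Lemma quot_rel_refl : reflexive quot_rel.
Proof. by move=> x; apply/asboolP; rewrite mulVg. Qed.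

Lemma quot_rel_sym : symmetric quot_rel.
Proof.
by move=> x y; apply/asboolP/asboolP => /NV; rewrite invgM invgK.
Qed.

Lemma quot_rel_trans : transitive quot_rel.
Proof.
move=> y x z /asboolP Nxy /asboolP Nyz; apply/asboolP.
by have := NM Nxy Nyz; rewrite -mulgA (mulgA y) mulgV mul1g.
Qed.

Canonical quot_equiv :=
  EquivRel quot_rel quot_rel_refl quot_rel_sym quot_rel_trans.

Definition quot_group := {eq_quot quot_equiv}.

HB.instance Definition _ := Choice.on quot_group.
HB.instance Definition _ := EqQuotient.on quot_group.

Definition quot_pi (x : G) : quot_group := \pi x.

Lemma quot_piP x y : quot_pi x = quot_pi y <-> normal_set N (x^-1 * y).
Proof.
rewrite /quot_pi; split=> [/eqmodP/asboolP //|Nxy].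
by apply/eqmodP/asboolP.
Qed.

Let quot_piK x : quot_pi (repr x) = x. Proof. exact: reprK. Qed.

Definition quot_mul (x y : quot_group) : quot_group :=
  quot_pi (repr x * repr y).
Definition quot_inv (x : quot_group) : quot_group := quot_pi (repr x)^-1.

Lemma quot_mulE x y : quot_mul (quot_pi x) (quot_pi y) = quot_pi (x * y).
Proof.
apply/quot_piP; set x' := repr _; set y' := repr _.
have Nx : normal_set N (x'^-1 * x) by apply/quot_piP; rewrite quot_piK.
have Ny : normal_set N (y'^-1 * y) by apply/quot_piP; rewrite quot_piK.
have := NM (NJ y' Nx) Ny.
by rewrite invgM conjgE -!mulgA (mulgA y' y'^-1) mulgV mul1g.
Qed.

Lemma quot_invE x : quot_inv (quot_pi x) = quot_pi x^-1.
Proof.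
apply/quot_piP; set x' := repr _.
have Nx : normal_set N (x^-1 * x') by apply/quot_piP; rewrite quot_piK.
by have := NJ x^-1 Nx; rewrite conjgE !invgK !mulgA mulgV mul1g.
Qed.

Lemma quot_mulA : associative quot_mul.
Proof.
move=> x y z; rewrite -(quot_piK x) -(quot_piK y) -(quot_piK z).
by rewrite !quot_mulE mulgA.
Qed.

Lemma quot_mul1g : left_id (quot_pi 1) quot_mul.
Proof. by move=> x; rewrite -(quot_piK x) quot_mulE mul1g. Qed.

Lemma quot_mulg1 : right_id (quot_pi 1) quot_mul.
Proof. by move=> x; rewrite -(quot_piK x) quot_mulE mulg1. Qed.

Lemma quot_mulVg : left_inverse (quot_pi 1) quot_inv quot_mul.
Proof. by move=> x; rewrite -(quot_piK x) quot_invE quot_mulE mulVg. Qed.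

Lemma quot_mulgV : right_inverse (quot_pi 1) quot_inv quot_mul.
Proof. by move=> x; rewrite -(quot_piK x) quot_invE quot_mulE mulgV. Qed.

HB.instance Definition _ := isGroup.Build quot_group
  quot_mulA quot_mul1g quot_mulg1 quot_mulVg quot_mulgV.

End QuotientGroup.

Section FreeGroup.
Variable T : choiceType.

(* A letter (t, false) stands for the generator t, (t, true) for t^-1. *)
Definition word := seq (T * bool).

Inductive free_eq : word -> word -> Prop :=
| free_eq_refl u : free_eq u u
| free_eq_sym u v : free_eq u v -> free_eq v u
| free_eq_trans u v w : free_eq u v -> free_eq v w -> free_eq u w
| free_eq_cancel u v t b : free_eq (u ++ (t, b) :: (t, ~~ b) :: v) (u ++ v).

Definition free_rel : rel word := fun u v => `[< free_eq u v >].

Lemma free_rel_refl : reflexive free_rel.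
Proof. by move=> u; apply/asboolP; exact: free_eq_refl. Qed.

Lemma free_rel_sym : symmetric free_rel.
Proof. by move=> u v; apply/asboolP/asboolP => /free_eq_sym. Qed.

Lemma free_rel_trans : transitive free_rel.
Proof.
move=> v u w /asboolP uv /asboolP vw; apply/asboolP.
exact: free_eq_trans uv vw.
Qed.

Canonical free_equiv :=
  EquivRel free_rel free_rel_refl free_rel_sym free_rel_trans.

Definition free_group := {eq_quot free_equiv}.

HB.instance Definition _ := Choice.on free_group.
HB.instance Definition _ := EqQuotient.on free_group.

Definition free_pi (u : word) : free_group := \pi u.

Lemma free_piP u v : free_pi u = free_pi v <-> free_eq u v.
Proof.
rewrite /free_pi; split=> [/eqmodP/asboolP //|uv].
by apply/eqmodP/asboolP.
Qed.

Let free_piK x : free_pi (repr x) = x. Proof. exact: reprK. Qed.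

Definition word_inv (u : word) : word := rev [seq (l.1, ~~ l.2) | l <- u].

Lemma word_invK : involutive word_inv.
Proof.
move=> u; rewrite /word_inv map_rev revK -map_comp map_id_in // => -[t b] _ /=.
by rewrite negbK.
Qed.

Lemma word_inv_cat u v : word_inv (u ++ v) = word_inv v ++ word_inv u.
Proof. by rewrite /word_inv map_cat rev_cat. Qed.

Lemma free_eq_cat u u' v v' :
  free_eq u u' -> free_eq v v' -> free_eq (u ++ v) (u' ++ v').
Proof.
move=> uu' vv'; apply: (@free_eq_trans _ (u' ++ v)).
  elim: uu' => {u u'} [u|u w _ /free_eq_sym //|u w z _ + _|u w t b].
  - exact: free_eq_refl.
  - exact: free_eq_trans.
  - by rewrite -!catA; exact: free_eq_cancel.
elim: vv' => {v v'} [v|v w _ /free_eq_sym //|v w z _ + _|v w t b].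
- exact: free_eq_refl.
- exact: free_eq_trans.
- by rewrite !catA; exact: free_eq_cancel.
Qed.

Lemma free_eq_inv u v : free_eq u v -> free_eq (word_inv u) (word_inv v).
Proof.
elim=> {u v} [u|u v _ /free_eq_sym //|u v w _ + _|u v t b].
- exact: free_eq_refl.
- exact: free_eq_trans.
- rewrite !word_inv_cat -[(t, b) :: _]/([:: (t, b); (t, ~~ b)] ++ v).
  rewrite word_inv_cat [word_inv [:: _; _]]/word_inv /= -catA /= negbK.
  exact: free_eq_cancel.
Qed.

Lemma free_eq_mulVw u : free_eq (word_inv u ++ u) [::].
Proof.
elim: u => [|[t b] u IHu]; first exact: free_eq_refl.
rewrite -cat1s word_inv_cat -catA; apply: free_eq_trans IHu.
by have := free_eq_cancel (word_inv u) u t (~~ b); rewrite negbK.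
Qed.

Definition free_mul (x y : free_group) : free_group :=
  free_pi (repr x ++ repr y).
Definition free_inv (x : free_group) : free_group :=
  free_pi (word_inv (repr x)).

Lemma free_mulE u v : free_mul (free_pi u) (free_pi v) = free_pi (u ++ v).
Proof.
by apply/free_piP/free_eq_cat; apply/free_piP; rewrite free_piK.
Qed.

Lemma free_invE u : free_inv (free_pi u) = free_pi (word_inv u).
Proof. by apply/free_piP/free_eq_inv/free_piP; rewrite free_piK. Qed.

Lemma free_mulA : associative free_mul.
Proof.
move=> x y z; rewrite -(free_piK x) -(free_piK y) -(free_piK z).
by rewrite !free_mulE catA.
Qed.

Lemma free_mul1g : left_id (free_pi [::]) free_mul.
Proof. by move=> x; rewrite -(free_piK x) free_mulE. Qed.

Lemma free_mulg1 : right_id (free_pi [::]) free_mul.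
Proof. by move=> x; rewrite -(free_piK x) free_mulE cats0. Qed.

Lemma free_mulVg : left_inverse (free_pi [::]) free_inv free_mul.
Proof.
move=> x; rewrite -(free_piK x) free_invE free_mulE.
by apply/free_piP/free_eq_mulVw.
Qed.

Lemma free_mulgV : right_inverse (free_pi [::]) free_inv free_mul.
Proof.
move=> x; rewrite -(free_piK x) free_invE free_mulE; apply/free_piP.
by rewrite -[X in X ++ _]word_invK; exact: free_eq_mulVw.
Qed.

HB.instance Definition _ := isGroup.Build free_group
  free_mulA free_mul1g free_mulg1 free_mulVg free_mulgV.

Definition free_gen (t : T) : free_group := free_pi [:: (t, false)].

End FreeGroup.

Definition presented_group (T : choiceType) (R : set (free_group T)) :
    groupType :=
  quot_group (normal_closure_group R).

Definition C_relators (n : nat) : set (free_group bool) :=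
  let x := free_gen true in
  let y := free_gen false in
  [set x ^+ n; y ^+ n; (x * y) ^+ n; (x * y^-1) ^+ n; (x * y ^- 2) ^+ n;
       (x * y^-1 * x * y ^- 2) ^+ n].

Definition C_group (n : nat) : groupType := presented_group (C_relators n).

Definition Sigma (G : groupType) (a c : G) : set G :=
  \bigcup_(g in [set: G]) \bigcup_(i in [set: nat])
    [set g * a ^+ i * g^-1; g * c ^+ i * g^-1; g * (a * c) ^+ i * g^-1].

Definition unmixed_Beauville_structure (G : groupType) (a1 c1 a2 c2 : G) :
    Prop :=
  [/\ gen [set a1; c1] = [set: G],
      gen [set a2; c2] = [set: G]
    & Sigma a1 c1 `&` Sigma a2 c2 = [set 1]].

(* The notion is only defined for finite groups, hence the first conjunct. *)
Definition admits_unmixed_Beauville (G : groupType) : Prop :=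
  finite_set [set: G] /\
  exists a1 c1 a2 c2 : G, unmixed_Beauville_structure a1 c1 a2 c2.

(* Main.v *)
Require Import Defs.
From HB Require Import structures.
From mathcomp Require Import zmodp all_boot.
From mathcomp Require Import boolp classical_sets cardinality.

(** The structure used is (x, y; x * y^2, x * y^-1), with x and y the images of
    the two generators in G = C[n] / N.

    Generation of G by the second pair: it contains
    (x * y^-1)^-1 * (x * y^2) = y^3, and y^n = 1 with n prime to 3, so that it
    contains y, hence x.

    Disjointness: since N lies in the commutator subgroup, every assignment of
    values in Z/n to x and y extends to a homomorphism from G to Z/n
    ([quotient_character]).  With z a generator of Z/n, in multiplicative
    notation, each of the three elements of the second triple is killed by one
    of them:

           killed                  x       y      x * y

           x * y^2                 z^2     z^-1    z
           x * y^-1                z       z       z^2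
           x * y^2 * (x * y^-1)    z       z^-2    z^-1

    and, n being odd, all the values on the first triple still have order n.  If
    an element g is both a conjugate of a^i, with a in the first triple, and a
    conjugate of a power of b, with b in the second, then the homomorphism chi
    that kills b kills g, so chi(a)^i = 1 and n divides i; as a^n = 1, this
    forces g = 1 ([killed_conjugate_trivial]).

    The pair (x * y^-1, x * y^-2), which the relators suggest, would not do as
    second pair when 5 divides n and G = (Z/n)^2: the triples then contain
    (1, 1) and (2, -3), in additive notation, whose multiples by 2n/5 and n/5
    coincide and are nonzero. *)

Local Open Scope classical_set_scope.
Local Open Scope group_scope.

(** * Homomorphisms out of free groups and quotients *)

Section FreeLift.
Variables (T : choiceType) (H : groupType) (f : T -> H).

Definition letter_value (l : T * bool) : H :=
  if l.2 then (f l.1)^-1 else f l.1.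

Definition word_value (u : word T) : H := \prod_(l <- u) letter_value l.

Lemma word_value_free_eq u v : free_eq u v -> word_value u = word_value v.
Proof.
elim=> {u v} [//|u v _ -> //|u v w _ -> _ -> //|u v t b].
rewrite /word_value !big_cat /= !big_cons /letter_value /=.
by case: b; rewrite /= ?mulKg ?mulVKg.
Qed.

Definition free_lift (x : free_group T) : H := word_value (repr x).

Lemma free_lift_pi u : free_lift (free_pi u) = word_value u.
Proof. by apply/word_value_free_eq/free_piP; rewrite /free_pi reprK. Qed.

Lemma free_lift_morph : monoid_morphism free_lift.
Proof.
split=> [|x y]; first by rewrite [LHS]free_lift_pi /word_value big_nil.
by rewrite [LHS]free_lift_pi /word_value big_cat.
Qed.

HB.instance Definition _ :=
  isUMagmaMorphism.Build _ _ free_lift free_lift_morph.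

Lemma free_lift_gen t : free_lift (free_gen t) = f t.
Proof. by rewrite free_lift_pi /word_value big_seq1. Qed.

End FreeLift.

Section QuotientLift.
Variables (G : groupType) (N : normal_subgroup G).

Lemma quot_pi_morph : monoid_morphism (quot_pi N).
Proof. by split=> // x y; rewrite -[LHS]quot_mulE. Qed.

HB.instance Definition _ :=
  isUMagmaMorphism.Build _ _ (quot_pi N) quot_pi_morph.

Lemma quot_pi_surj (q : quot_group N) : exists x, quot_pi N x = q.
Proof. by exists (repr q); exact: reprK. Qed.

Variables (H : groupType) (phi : UMagmaMorphism.type G H).
Hypothesis phiN : forall x, normal_set N x -> phi x = 1.

(** The hypothesis is an argument, so that the homomorphism structure declared
    below can depend on it. *)
Definition quot_lift of (forall x, normal_set N x -> phi x = 1) :=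
  fun q : quot_group N => phi (repr q).

Lemma quot_lift_pi x : quot_lift phiN (quot_pi N x) = phi x.
Proof.
have /phiN : normal_set N ((repr (quot_pi N x))^-1 * x).
  by apply/quot_piP; exact: reprK.
by rewrite gmulfM gmulfV => /mulg1_eq; rewrite invgK.
Qed.

Lemma quot_lift_morph : monoid_morphism (quot_lift phiN).
Proof.
split=> [|p q].
  by rewrite -[1](@gmulf1 _ _ (quot_pi N)) quot_lift_pi gmulf1.
have [[x <-] [y <-]] := (quot_pi_surj p, quot_pi_surj q).
by rewrite -gmulfM !quot_lift_pi gmulfM.
Qed.

HB.instance Definition _ :=
  isUMagmaMorphism.Build _ _ (quot_lift phiN) quot_lift_morph.

End QuotientLift.

(** * Subgroups *)

Section Subgroups.
Variable G : groupType.
Implicit Types (A K : set G).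

Lemma gen_subgroup A : is_subgroup (gen A).
Proof.
split=> [K [[]] //|x y Ax Ay K KP|x Ax K KP].
  by case: (KP) => -[_ mK _] _; apply: mK; [apply: Ax | apply: Ay].
by case: (KP) => -[_ _ iK] _; apply: iK; apply: Ax.
Qed.

Lemma sub_gen A : A `<=` gen A.
Proof. by move=> x Ax K [_]; apply. Qed.

Lemma gen_sub A K : is_subgroup K -> A `<=` K -> gen A `<=` K.
Proof. by move=> Ksub AK x; apply. Qed.

Lemma subgroupX K x i : is_subgroup K -> K x -> K (x ^+ i).
Proof.
move=> [K1 KM _] Kx; elim: i => [//|i Ki]; rewrite expgS; exact: KM.
Qed.

Lemma kernel_normal (H : groupType) (phi : UMagmaMorphism.type G H) :
  is_normal [set x | phi x = 1].
Proof.
split; [split=> [|x y /= fx fy|x /= fx]|move=> x g /= fx].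
- exact: gmulf1.
- by rewrite gmulfM fx fy mulg1.
- by rewrite gmulfV fx invg1.
- by rewrite gmulfJ fx conj1g.
Qed.

Lemma derived_subgroup_kernel (H : groupType)
    (phi : UMagmaMorphism.type G H) :
  (forall a b : H, commute a b) ->
  derived_subgroup G `<=` [set x | phi x = 1].
Proof.
move=> Hcomm; apply: gen_sub; first by case: (kernel_normal _ phi).
move=> _ [x [y ->]] /=; rewrite gmulfR; apply/eqP/commgP; exact: Hcomm.
Qed.

(** The map from G / N to the set of cosets is injective. *)
Lemma finite_quot_group (N : normal_subgroup G) :
  finite_index N -> finite_set [set: quot_group N].
Proof.
move=> Nfin; pose coset (q : quot_group N) := lcoset_of N (repr q).
have N1 : normal_set N 1 by case: (normal_setP N) => -[].
suff -> : [set: quot_group N] = coset @^-1` range (lcoset_of N).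
  apply: finite_preimage Nfin => p q _ _ eq_pq.
  have : coset q (repr q) by exists 1; rewrite ?mulg1.
  rewrite -eq_pq => -[h Nh def_q].
  rewrite -[p]reprK -[q]reprK; apply/(quot_piP N).
  by rewrite -def_q mulKg.
by apply/seteqP; split=> // q _; exists (repr q).
Qed.

End Subgroups.

Lemma gen_free_group (T : choiceType) (K : set (free_group T)) :
  is_subgroup K -> (forall t, K (free_gen t)) -> K = [set: free_group T].
Proof.
move=> [K1 KM KV] Kgen; apply/seteqP; split=> // x _.
rewrite -[x]reprK -/(free_pi _); elim: (repr x) => [//|[t b] u Ku].
rewrite -cat1s -free_mulE; apply: KM Ku.
case: b; last exact: Kgen.
by have := KV _ (Kgen t); rewrite -[_^-1]/(free_inv _) free_invE.
Qed.

Lemma quot_pi_preimage_subgroup (G : groupType) (N : normal_subgroup G)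
    (K : set (quot_group N)) :
  is_subgroup K -> is_subgroup [set x | K (quot_pi N x)].
Proof.
move=> [K1 KM KV]; split=> [|x y /= Kx Ky|x /= Kx].
- by rewrite /= gmulf1.
- by rewrite gmulfM; exact: KM.
- by rewrite gmulfV; exact: KV.
Qed.

(** * Separating two triples by characters *)

(** H being commutative, chi takes the same values on conjugate elements, so
    that chi(a)^i = chi(b)^j = 1, whence n divides i. *)
Lemma killed_conjugate_trivial (G H : groupType) (n : nat)
    (chi : UMagmaMorphism.type G H) (a b g h : G) (i j : nat) :
  (forall u v : H, commute u v) ->
  a ^+ n = 1 -> (forall k, chi a ^+ k = 1 -> n %| k) -> chi b = 1 ->
  g * a ^+ i * g^-1 = h * b ^+ j * h^-1 -> g * a ^+ i * g^-1 = 1.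
Proof.
move=> Hcomm an1 chi_a chi_b eq_ab.
have chiJ (k u : G) : chi (k * u * k^-1) = chi u.
  by rewrite !gmulfM Hcomm mulgA -gmulfM mulVg gmulf1 mul1g.
have /chi_a/dvdnP[q ->] : chi a ^+ i = 1.
  by rewrite -gmulfXn -(chiJ g) eq_ab chiJ gmulfXn chi_b expg1n.
by rewrite mulnC expgnA an1 expg1n mulg1 mulgV.
Qed.

Lemma SigmaP (G : groupType) (a c g : G) :
  Sigma a c g <->
  exists u h i, [\/ u = a, u = c | u = a * c] /\ g = h * u ^+ i * h^-1.
Proof.
split=> [[h _ [i _ [[]|]] ->]|[u [h [i [u_ac ->]]]]].
- by exists a, h, i; split=> //; constructor 1.
- by exists c, h, i; split=> //; constructor 2.
- by exists (a * c), h, i; split=> //; constructor 3.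
exists h => //; exists i => //.
by case: u_ac => ->; [left; left | left; right | right].
Qed.

Lemma Sigma1 (G : groupType) (a c : G) : Sigma a c 1.
Proof.
apply/SigmaP; exists a, 1, 0; split; first by constructor 1.
by rewrite expg0 !mul1g invg1.
Qed.

(** The character may depend on the element b of the second triple, but must
    treat the whole first triple at once: this is what makes three characters
    enough for the nine pairs of elements. *)
Lemma Sigma_disjoint (G H : groupType) (n : nat) (a1 c1 a2 c2 : G) :
  (forall u v : H, commute u v) ->
  a1 ^+ n = 1 -> c1 ^+ n = 1 -> (a1 * c1) ^+ n = 1 ->
  (forall b, [\/ b = a2, b = c2 | b = a2 * c2] ->
     exists chi : UMagmaMorphism.type G H, chi b = 1 /\
       forall a, [\/ a = a1, a = c1 | a = a1 * c1] ->
         forall k, chi a ^+ k = 1 -> n %| k) ->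
  Sigma a1 c1 `&` Sigma a2 c2 = [set 1].
Proof.
move=> Hcomm a1n c1n ac1n sep; apply/seteqP; split=> [g|_ ->]; last first.
  by split; exact: Sigma1.
move=> [/SigmaP[a [h [i [aP ->]]]] /SigmaP[b [k [j [bP eq_ab]]]]].
have [chi [chi_b chi_a]] := sep b bP.
have an : a ^+ n = 1 by case: aP => ->.
exact: killed_conjugate_trivial Hcomm an (chi_a a aP) chi_b eq_ab.
Qed.

Lemma subgroup_coprime_root (G : groupType) (K : set G) (n k : nat) (y : G) :
  is_subgroup K -> 0 < k -> coprime k n -> y ^+ n = 1 -> K (y ^+ k) -> K y.
Proof.
move=> Ksub k_gt0 /eqP co_kn yn1 Kyk; case: (egcdnP n k_gt0) => u v def_uk _.
suff -> : y = (y ^+ k) ^+ u by exact: subgroupX.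
by rewrite -expgnA mulnC def_uk co_kn expgnDr mulnC expgnA yn1 expg1n mul1g.
Qed.

(** Since n is prime to 6, y can be recovered from y^3, so that the second pair
    generates G, and z, z^2 and their inverses have order n in H, so that
    [Sigma_disjoint] applies to three well-chosen characters. *)
Lemma beauville_of_characters (G H : groupType) (n : nat) (x y : G) (z : H) :
  coprime n 6 -> gen [set x; y] = [set: G] ->
  x ^+ n = 1 -> y ^+ n = 1 -> (x * y) ^+ n = 1 ->
  (forall u v : H, commute u v) -> (forall k, z ^+ k = 1 -> n %| k) ->
  (forall a b : H, exists chi : UMagmaMorphism.type G H,
     chi x = a /\ chi y = b) ->
  unmixed_Beauville_structure x y (x * y ^+ 2) (x * y^-1).
Proof.
rewrite (coprimeMr n 2 3) => /andP[co_n2 co_n3].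
move=> genxy xn yn xyn Hcomm zP charP; split=> //.
  apply/seteqP; split=> //; rewrite -genxy; set L := gen [set _ * _; _].
  have Lsub : is_subgroup L by exact: gen_subgroup.
  have [_ LM LV] := Lsub.
  have Lxy2 : L (x * y ^+ 2) by apply: sub_gen; left.
  have Lxy' : L (x * y^-1) by apply: sub_gen; right.
  have Ly : L y.
    apply: (subgroup_coprime_root _ L n 3 y) => //.
      by rewrite coprime_sym.
    (* (x * y^-1)^-1 * (x * y^2) = y^3 *)
    by have := LM _ _ (LV _ Lxy') Lxy2; rewrite invgM invgK -mulgA mulKg -expgS.
  have Lx : L x by have := LM _ _ Lxy' Ly; rewrite mulgVK.
  by apply: gen_sub => // _ [] ->.
have zV (w : H) : (forall k, w ^+ k = 1 -> n %| k) ->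
    forall k, w^-1 ^+ k = 1 -> n %| k.
  by move=> wP k; rewrite expVgn => /eqP; rewrite invg_eq1 => /eqP/wP.
have z2P k : (z ^+ 2) ^+ k = 1 -> n %| k.
  by rewrite -expgnA => /zP; rewrite Gauss_dvdr.
apply: (Sigma_disjoint _ _ n) => // b [] ->.
(* The three characters are the rows of the table in the introduction. *)
- have [chi [chix chiy]] := charP (z ^+ 2) z^-1; exists chi.
  rewrite gmulfM gmulfXn chix chiy expVgn mulgV; split=> // a [] ->.
  + by rewrite chix.
  + by rewrite chiy; exact: zV.
  + by rewrite gmulfM chix chiy expg2 mulgK.
- have [chi [chix chiy]] := charP z z; exists chi.
  rewrite gmulfM gmulfV chix chiy mulgV; split=> // a [] ->.
  + by rewrite chix.
  + by rewrite chiy.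
  + by rewrite gmulfM chix chiy -expg2.
- have [chi [chix chiy]] := charP z (z ^- 2); exists chi; split=> [|a [] ->].
  + by rewrite !gmulfM gmulfV chix !chiy expg2 !gnorm.
  + by rewrite chix.
  + by rewrite chiy; exact: zV.
  + by rewrite gmulfM chix chiy expg2 invgM mulVKg; exact: zV.
Qed.

(** * Quotients of C[n] *)

(** Each relator is an n-th power, hence dies in H whatever the images of the
    generators are; N dies as well, being made of products of commutators. *)
Lemma quotient_character (n : nat) (N : normal_subgroup (C_group n))
    (H : groupType) (a b : H) :
  normal_set N `<=` derived_subgroup (C_group n) ->
  (forall u v : H, commute u v) -> (forall u : H, u ^+ n = 1) ->
  exists chi : UMagmaMorphism.type (quot_group N) H,
    chi (quot_pi N (quot_pi _ (free_gen true))) = a /\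
    chi (quot_pi N (quot_pi _ (free_gen false))) = b.
Proof.
move=> Nder Hcomm Hn.
pose phi : UMagmaMorphism.type (free_group bool) H :=
  free_lift bool H (fun t => if t then a else b).
have phiR x : normal_set (normal_closure_group (C_relators n)) x -> phi x = 1.
  move=> /(_ [set w | phi w = 1]); apply.
  split; first exact: (kernel_normal _ _ phi).
  by move=> _ [[[[[|]|]|]|]|] -> /=; rewrite gmulfXn Hn.
pose psi : UMagmaMorphism.type (C_group n) H := quot_lift _ _ _ _ phiR.
have psiN x : normal_set N x -> psi x = 1.
  by move=> /Nder; exact: derived_subgroup_kernel.
exists (quot_lift _ _ _ _ psiN).
by split; rewrite [LHS]quot_lift_pi [LHS]quot_lift_pi [LHS]free_lift_gen.
Qed.

Lemma quotient_generated (n : nat) (N : normal_subgroup (C_group n)) :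
  gen [set quot_pi N (quot_pi _ (free_gen true));
           quot_pi N (quot_pi _ (free_gen false))] = [set: quot_group N].
Proof.
set K := gen _; have Ksub : is_subgroup K by exact: gen_subgroup.
apply/seteqP; split=> // q _.
have [c <-] := quot_pi_surj _ _ q; have [w <-] := quot_pi_surj _ _ c.
have := gen_free_group _ _ (quot_pi_preimage_subgroup _ _ _
  (quot_pi_preimage_subgroup _ _ _ Ksub)).
move=> /(_ _)/seteqP[|_]; last exact.
by case; apply: sub_gen; [left | right].
Qed.

Theorem proposition3p10 (n : nat) (hn : gcdn n 6 = 1%N)
    (N : normal_subgroup (C_group n))
    (hN : normal_set N `<=` derived_subgroup (C_group n))
    (hfin : finite_index (normal_set N)) :
  admits_unmixed_Beauville (quot_group N).
Proof.
split; first exact: finite_quot_group.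
pose gen_image t :=
  quot_pi N (quot_pi (normal_closure_group (C_relators n)) (free_gen t)).
pose x := gen_image true; pose y := gen_image false.
exists x, y, (x * y ^+ 2), (x * y^-1).
(* As gcd(0, 6) = 6, n is positive, and Z/n is ['I_n]. *)
case: n => [//|m] in hn N hN hfin gen_image x y *.
have relator w : C_relators m.+1 w ->
    quot_pi N (quot_pi (normal_closure_group (C_relators m.+1)) w) = 1.
  move=> Rw; rewrite -[RHS](@gmulf1 _ _ (quot_pi N)); congr (quot_pi N _).
  apply/esym/quot_piP; rewrite invg1 mul1g => K [_]; exact.
apply: (beauville_of_characters _ 'I_m.+1 m.+1 _ _ Zp1).
- exact/eqP.
- exact: quotient_generated.
- by rewrite -!gmulfXn; apply: relator; do 5 left.
- by rewrite -!gmulfXn; apply: relator; do 4 left; right.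
- by rewrite -!gmulfM -!gmulfXn; apply: relator; do 3 left; right.
- exact: Zp_mulgC.
- move=> k; rewrite Zp_expg => /(congr1 val) /=.
  by rewrite modnMml mul1n => /eqP.
- move=> a b; apply: quotient_character => // [|u]; first exact: Zp_mulgC.
  by rewrite Zp_expg; apply: val_inj; rewrite /= modnMl.
Qed.
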